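(* Let $p$ be a prime and let $G$ be a reduced abelian $p$-group. Then the following conditions are equivalent: (a) $s(G)=0$; (b) $s_0(G)=0$; (c) $G$ is finite. In particular, $s(G)=s_0(G)$.
   Context: $\mathbb N=\{0,1,2,\dots\}$ and $\mathbb N_+=\mathbb N\setminus\{0\}$. Let $\phi$ be an endomorphism of an abelian group $G$. A string of $\phi$ is a sequence $S=\{x_n\}_{n\in\mathbb N}$ of pairwise distinct elements of $G$ such that $\phi(x_n)=x_{n-1}$ for every $n\in\mathbb N_+$. It is a null string if $x_0\neq 0$ and $\phi^k(x_0)=0$ for some $k\in\mathbb N_+$. Define $s(\phi)$ (respectively $s_0(\phi)$) as the supremum of the cardinalities $|\mathcal F|$, where $\mathcal F$ ranges over the families of pairwise disjoint strings (respectively null strings) of $\phi$; if this supremum is infinite it is set equal to the symbol $\infty$. For an abelian group $G$, $s(G)=\sup\{s(\phi):\phi\in\mathrm{End}(G)\}$ and $s_0(G)=\sup\{s_0(\phi):\phi\in\mathrm{End}(G)\}$. An abelian group is reduced if its maximum divisible subgroup is trivial. *)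

(* Defs.v *)
From HB Require Import structures.
From mathcomp Require Import all_boot all_order all_algebra.
From mathcomp Require Import finmap boolp classical_sets functions cardinality.
From mathcomp Require Import constructive_ereal.

Set Implicit Arguments.
Unset Strict Implicit.
Unset Printing Implicit Defensive.

Import Order.TTheory GRing.Theory Num.Theory.

Local Open Scope classical_set_scope.
Local Open Scope ring_scope.

(* Elements of N u {oo} are represented in [\bar int]; all infinite
   cardinalities are identified with [+oo]. *)
Definition ecard (T : choiceType) (A : set T) : \bar int :=
  if `[< finite_set A >] then (#|` fset_set A|)%:Z%:E else +oo%E.

Definition esup (A : set (\bar int)) : \bar int := supremum 0%E A.

Lemma ecard_ge0 (T : choiceType) (A : set T) : (0 <= ecard A)%E.
Proof. by rewrite /ecard; case: ifP. Qed.

Lemma esup_ge0 (A : set (\bar int)) :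
  (forall x, A x -> (0 <= x)%E) -> (0 <= esup A)%E.
Proof.
move=> A0; rewrite /esup /supremum; case: ifPn => // /set0P[x Ax].
by case: xgetP => // y -> [ubA _]; exact: le_trans (A0 _ Ax) (ubA _ Ax).
Qed.

(* [supremum] returns its default value when no least upper bound exists; this
   never happens for nonempty sets of nonnegative elements. *)
Lemma esupP (A : set (\bar int)) : A !=set0 ->
  (forall x, A x -> (0 <= x)%E) -> supremums A (esup A).
Proof.
move=> AN0 A0; suff [y Ay] : supremums A !=set0.
  rewrite /esup /supremum ifF; first by case: xgetP => [//|/(_ y)].
  by apply/negP => /eqP A_eq0; move: AN0; rewrite A_eq0 => -[].
pose P (n : nat) := `[< ubound A n%:Z%:E >].
have [exP|nexP] := pselect (exists n, P n).
  have [n /asboolP ubn minn] := ex_minnP exP.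
  exists n%:Z%:E; split=> // -[[m|m]| |] ubm.
  - by rewrite lee_fin; apply: minn; apply/asboolP.
  - by have [x Ax] := AN0; have := le_trans (A0 x Ax) (ubm x Ax).
  - exact: leey.
  - by have [x Ax] := AN0; have := le_trans (A0 x Ax) (ubm x Ax).
exists +oo%E; split=> [x _|]; first exact: leey.
move=> -[[m|m]| |] // ubm; last first.
- by have [x Ax] := AN0; have := le_trans (A0 x Ax) (ubm x Ax).
- by have [x Ax] := AN0; have := le_trans (A0 x Ax) (ubm x Ax).
- by exfalso; apply: nexP; exists m; apply/asboolP.
Qed.

Section Strings.
Variable G : zmodType.
Implicit Types (phi : {additive G -> G}) (S : nat -> G) (F : set (nat -> G)).

Definition is_string phi S : Prop :=
  injective S /\ forall n, (0 < n)%N -> phi (S n) = S n.-1.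

Definition is_null_string phi S : Prop :=
  [/\ is_string phi S, S 0%N != 0
    & exists2 k, (0 < k)%N & iter k phi (S 0%N) = 0].

(* Disjointness of strings is disjointness of their underlying sets [range S]. *)
Definition string_number phi : \bar int :=
  esup [set ecard F | F in
    [set F | (forall S, F S -> is_string phi S)
             /\ trivIset F (fun S => range S)]].

Definition null_string_number phi : \bar int :=
  esup [set ecard F | F in
    [set F | (forall S, F S -> is_null_string phi S)
             /\ trivIset F (fun S => range S)]].

End Strings.

Definition group_string_number (G : zmodType) : \bar int :=
  esup [set string_number phi | phi in [set: {additive G -> G}]].

Definition group_null_string_number (G : zmodType) : \bar int :=
  esup [set null_string_number phi | phi in [set: {additive G -> G}]].

Section Groups.
Variable G : zmodType.
Implicit Types D E : {pred G}.

Definition is_divisible_subgroup D : Prop :=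
  zmod_closed D /\
  forall n x, (0 < n)%N -> x \in D -> exists2 y, y \in D & y *+ n = x.

Definition is_max_divisible_subgroup D : Prop :=
  is_divisible_subgroup D /\
  forall E, is_divisible_subgroup E -> {subset E <= D}.

End Groups.

Definition reduced (G : zmodType) : Prop :=
  is_max_divisible_subgroup (pred1 (0 : G)).

Definition abelian_pgroup (p : nat) (G : zmodType) : Prop :=
  forall x : G, exists n, x *+ p ^ n = 0.

(* Main.v *)
Require Import Defs.
From HB Require Import structures.
From mathcomp Require Import all_boot all_order all_algebra.
From mathcomp Require Import finmap boolp classical_sets functions cardinality.
From mathcomp Require Import constructive_ereal.

Set Implicit Arguments.
Unset Strict Implicit.
Unset Printing Implicit Defensive.

Import Order.TTheory GRing.Theory Num.Theory.

Local Open Scope classical_set_scope.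
Local Open Scope ring_scope.

(** A finite group has no string, because the terms of a string are pairwise
    distinct.  Everything else follows from the fact that an infinite reduced
    [p]-group [G] satisfies [s_0(G) = oo], since [s_0 <= s].

    One null string of one endomorphism suffices for that
    ([infinite_null_string_number]): the terms whose indices lie in a fixed
    residue class modulo [k] form a null string of [phi ^ k], so that
    [s_0(phi ^ k) >= k].  To produce a null string it is enough to find an
    endomorphism acting on a sequence [b 0], [b 1], ... of [G] in a triangular
    way: it annihilates [b 0], which is nonzero, and maps [b k.+1] to [b k] plus
    an integer combination of earlier terms
    ([triangular_infinite_null_string_number]).

    Such endomorphisms come from direct summands, which are obtained from a
    variant of the injectivity of Z / p ^ n over itself
    ([retraction_mod_pure]).  There are two cases.

    If the finite heights of elements of the socle are unbounded, [G] has cyclic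
    direct summands of arbitrarily large order.  Along a sequence of them whose
    exponents more than double at each step, the maps that project onto one
    summand and send its generator to the preceding generator have a locally
    finite sum, and this sum is triangular
    ([unbounded_infinite_null_string_number]).

    If these heights are bounded, some [p ^ N G] is divisible, hence trivial as
    [G] is reduced ([bounded_of_bounded_height]).  The socle is then infinite,
    and among the layers [(p ^ n G)[p]] there is a last infinite one.  Elements
    [b i] for which the [b i *+ p ^ n] are independent modulo the next layer span a
    direct sum of cyclic groups of order [p ^ n.+1] which is a direct summand
    of [G], and the shift of this sum extends to [G]
    ([bounded_infinite_null_string_number]). *)

Lemma additive_of (U V : zmodType) (f : U -> V) :
  (forall x y, f (x - y) = f x - f y) ->
  exists phi : {additive U -> V}, forall x, phi x = f x.
Proof.
move=> fB.
pose fm := GRing.isZmodMorphism.Build U V f fB.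
pose phi : {additive U -> V} := HB.pack f fm.
by exists phi.
Qed.

(** * Divisibility by an integer and extension of maps *)

Definition multiples (V : zmodType) (m : nat) : set V :=
  [set x | exists y, x = y *+ m].

Section Multiples.
Variable V : zmodType.
Implicit Types (x y : V) (m n : nat).

Lemma multiples0 m : multiples m (0 : V).
Proof. by exists 0; rewrite mul0rn. Qed.

Lemma multiplesD m x y : multiples m x -> multiples m y -> multiples m (x + y).
Proof. by move=> [a ->] [b ->]; exists (a + b); rewrite mulrnDl. Qed.

Lemma multiplesN m x : multiples m x -> multiples m (- x).
Proof. by move=> [a ->]; exists (- a); rewrite mulNrn. Qed.

Lemma multiplesB m x y : multiples m x -> multiples m y -> multiples m (x - y).
Proof. by move=> mx /multiplesN; exact: multiplesD. Qed.

Lemma multiplesMn m n x : multiples m x -> multiples (m * n) (x *+ n).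
Proof. by move=> [a ->]; exists a; rewrite mulrnA. Qed.

Lemma multiples_dvd m n x : (n %| m)%N -> multiples m x -> multiples n x.
Proof.
by move=> /dvdnP[k ->] [a ->]; exists (a *+ k); rewrite mulrnA.
Qed.

Lemma multiplesMz m x (c : int) : multiples m x -> multiples m (x *~ c).
Proof. by move=> [a ->]; exists (a *~ c); rewrite !pmulrn mulrzAC. Qed.

Lemma mulrz_multiples_eq0 (a : V) (m : nat) (c : int) :
  a *+ m = 0 -> multiples m c -> a *~ c = 0.
Proof.
by move=> am [d ->]; rewrite -mulr_natr natz mulrC mulrzA -pmulrn am mul0rz.
Qed.

End Multiples.

Section PrimeOrder.
Variables (p : nat) (p_prime : prime p).

Lemma prime_coprimez (c : int) : ~ (p %| c)%Z ->
  exists u v : int, u * c + v * p%:Z = 1.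
Proof.
move=> pc; have : coprimez c p%:Z.
  by rewrite /coprimez gcdzC /gcdz /= eqz_nat -/(coprime _ _) prime_coprime //;
     apply/negP.
by move=> /coprimezP[[u v] /= uv]; exists u, v.
Qed.

(** A form of the injectivity of [V / p ^ n V] as a module over Z / p ^ n, for
    [V] without [p]-torsion: the hypothesis on [e] says that the partial map
    sending [e v + y *+ p ^ n] to the class of [v] is well defined, and the
    conclusion extends it to the whole of [G].  The extension is a maximal
    additive relation between [G] and [V] that is single-valued modulo
    [p ^ n]; working with relations into [V] dispenses with forming the
    quotient.  A relation defined at [g *+ p] but not at [g] is not maximal:
    a value [v] there satisfies [v *+ p ^ n.-1] in [p ^ n V], hence is of the
    form [w *+ p], and [w] is an admissible value at [g]. *)
Lemma retraction_mod_pure (n : nat) (G V : zmodType) (e : {additive V -> G}) :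
  (forall v : V, v *+ p = 0 -> v = 0) ->
  (forall v : V, multiples (p ^ n) (e v) -> multiples (p ^ n) v) ->
  exists chi : G -> V,
    (forall x y, multiples (p ^ n) (chi (x - y) - (chi x - chi y))) /\
    (forall v, multiples (p ^ n) (chi (e v) - v)).
Proof.
move=> Vp epure.
have V_tf k (v : V) : v *+ p ^ k = 0 -> v = 0.
  by elim: k v => [//|k IH] v; rewrite expnSr mulrnA => /Vp/IH.
(* [R0] is the graph of the partial map to be extended. *)
pose R0 : set (G * V) := [set z | exists v y, z = (e v + y *+ p ^ n, v)].
pose sub (R : set (G * V)) := forall a b : G * V, R a -> R b -> R (a - b).
pose fct (R : set (G * V)) := forall v : V, R (0, v) -> multiples (p ^ n) v.
(* Stability under [R0], unlike inclusion of [R0], also holds for the empty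
   relation, which is the union of the empty chain. *)
pose ext (R : set (G * V)) := forall a r : G * V, R a -> R0 r -> R (a + r).
have [F FF totF|R [[Rsub Rfct Rext] Rmax]] :=
    @Zorn_bigcup _ [set R | [/\ sub R, fct R & ext R]].
  split.
  - move=> a b [X FX Xa] [Y FY Yb].
    have [XY|YX] := totF _ _ FX FY.
      by exists Y => //; have [+ _ _] := FF _ FY; apply=> //; exact: XY.
    by exists X => //; have [+ _ _] := FF _ FX; apply=> //; exact: YX.
  - by move=> v [X FX Xv]; have [_ + _] := FF _ FX; exact.
  - move=> a r [X FX Xa] R0r; exists X => //.
    by have [_ _] := FF _ FX; exact.
have R0sub : sub R0.
  move=> _ _ [v [y ->]] [w [z ->]]; exists (v - w), (y - z).
  rewrite raddfB mulrnBl; congr (_, _) => /=.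
  by rewrite opprD addrACA.
have R0z : R0 0 by exists 0, 0; rewrite raddf0 mul0rn addr0.
have R00 : R 0.
  have [[a Ra]|R0nz] := pselect (exists a, R a).
    by rewrite -(subrr a); exact: Rsub.
  exfalso; apply: (Rmax R0).
    split; first by move=> a Ra; case: R0nz; exists a.
    by move=> /(_ _ R0z) ?; case: R0nz; exists 0.
  split=> //.
  - move=> v [w [y [vE ->]]]; apply: epure; exists (- y).
    by apply/eqP; rewrite mulNrn -addr_eq0 -vE.
  - move=> a r Ra Rr; rewrite -(opprK r); apply: (R0sub _ _ Ra).
    by rewrite -(sub0r r); exact: R0sub.
have R0R r : R0 r -> R r by move=> ?; rewrite -(add0r r); exact: Rext.
have RN a : R a -> R (- a) by move=> Ra; rewrite -sub0r; exact: Rsub.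
have RD a b : R a -> R b -> R (a + b).
  by move=> Ra Rb; rewrite -(opprK b); apply: Rsub => //; exact: RN.
have RMn a m : R a -> R (a *+ m).
  by move=> Ra; elim: m => [|m IH]; rewrite ?mulr0n// mulrS; exact: RD.
have RMz a c : R a -> R (a *~ c).
  by case: c => m Ra; [exact: RMn|rewrite NegzE mulrNz; apply: RN; exact: RMn].
have pairMn (g : G) (w : V) m : (g, w) *+ m = (g *+ m, w *+ m).
  by elim: m => [|m IH]; rewrite ?mulr0n// !mulrS IH.
have pairMz (g : G) (w : V) c : (g, w) *~ c = (g *~ c, w *~ c).
  by case: c => m; rewrite ?NegzE ?mulrNz -!pmulrn pairMn.
have step (g : G) (v : V) : (0 < n)%N -> R (g *+ p, v) -> exists w, R (g, w).
  move=> n0 Rpg; apply: contrapT => Rg.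
  have [w vE] : multiples p v.
    have [w] : multiples (p ^ n) (v *+ p ^ n.-1).
      apply: Rfct; rewrite -(subrr (g *+ p ^ n)) -[X in (_, X)]subr0.
      apply: (Rsub (_, _) (_, _)); last first.
        by apply: R0R; exists 0, g; rewrite raddf0 add0r.
      by have := RMn _ (p ^ n.-1)%N Rpg; rewrite pairMn -mulrnA -expnS prednK.
    have -> : (p ^ n = p * p ^ n.-1)%N by rewrite -expnS prednK.
    rewrite mulrnA => /eqP.
    rewrite -subr_eq0 -mulrnBl => /eqP/V_tf/eqP.
    by rewrite subr_eq0 => /eqP ->; exists w.
  have Rdvd c (x : V) : R (g *~ c, x) -> (p %| c)%Z.
    move=> Rc; apply: contrapT => /prime_coprimez[a [b abE]].
    apply: Rg; exists (x *~ a + v *~ b).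
    rewrite -[X in (X, _)]mulr1z -abE mulrzDr.
    have := RD _ _ (RMz _ a Rc) (RMz _ b Rpg).
    by rewrite !pairMz pmulrn -!mulrzA [c * a]mulrC [_ * b]mulrC.
  pose R' : set (G * V) := [set z | exists r c, R r /\ z = r + (g, w) *~ c].
  apply: (Rmax R'); split.
  - by move=> r Rr; exists r, 0; rewrite mulr0z addr0.
  - move=> R'R; apply: Rg; exists w; apply: R'R.
    by exists 0, 1; rewrite add0r.
  - move=> _ _ [r [c [Rr ->]]] [r' [c' [Rr' ->]]].
    exists (r - r'), (c - c'); split; first exact: Rsub.
    by rewrite opprD addrACA mulrzBr.
  - move=> x [[a b] [c [Rab]]]; rewrite pairMz => -[gE ->].
    have gcE : g *~ c = - a by apply/eqP; rewrite -addr_eq0 addrC gE.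
    have /dvdzP[d cE] : (p %| c)%Z.
      by apply: (Rdvd _ (- b)); rewrite gcE; exact: (RN (a, b)).
    apply: Rfct.
    suff -> : (0, b + w *~ c) = (a, b) + (g *+ p, v) *~ d.
      by apply: RD => //; exact: RMz.
    rewrite pairMz vE cE gE; congr (_, _) => /=.
      by rewrite cE mulrC mulrzA.
    by rewrite [d * _]mulrC mulrzA.
  - move=> _ r [r1 [c [Rr1 ->]]] R0r; exists (r1 + r), c.
    by split; [exact: Rext|rewrite addrAC].
(* Divide by [p] repeatedly, starting from [g *+ p ^ n], where [R0] provides
   the value 0. *)
have Rtot g : exists w, R (g, w).
  have [n0|n_gt0] := posnP n.
    by exists 0; apply: R0R; exists 0, g; rewrite n0 raddf0 add0r.
  have : exists w, R (g *+ p ^ n, w).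
    by exists 0; apply: R0R; exists 0, g; rewrite raddf0 add0r.
  move: {1}n => m; elim: m => [//|m IH] [w].
  by rewrite expnSr mulrnA => /(step _ _ n_gt0).
have [chi Rchi] := choice Rtot.
exists chi; split=> [x y|v].
  apply: Rfct; rewrite -(subrr (x - y)).
  exact: (Rsub _ _ (Rchi _) (Rsub _ _ (Rchi x) (Rchi y))).
apply: Rfct; rewrite -(subrr (e v)); apply: (Rsub (_, _) (_, _) (Rchi _)).
by apply: R0R; exists v, 0; rewrite mul0rn addr0.
Qed.

End PrimeOrder.

(** * Strings and their number *)

Section Supremum.
Implicit Types (A B : set (\bar int)).

Lemma esup_ub A x : (forall y, A y -> (0 <= y)%E) -> A x -> (x <= esup A)%E.
Proof.
move=> A0 Ax; have [|+ _] := @esupP A _ A0; first by exists x.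
exact.
Qed.

Lemma esup_le A x : (0 <= x)%E -> (forall y, A y -> (0 <= y)%E) ->
  (forall y, A y -> (y <= x)%E) -> (esup A <= x)%E.
Proof.
move=> x0 A0 Ax; have [A_ex|A_nex] := pselect (A !=set0).
  by have [_] := esupP A_ex A0; apply.
by rewrite /esup /supremum ifT//; have [//|/set0P] := boolP (A == set0).
Qed.

End Supremum.

Section Strings.
Variable G : zmodType.
Implicit Types (phi : {additive G -> G}) (S : nat -> G).

Lemma string_number_ge0 phi : (0 <= string_number phi)%E.
Proof. by apply: esup_ge0 => _ [F _ <-]; exact: ecard_ge0. Qed.

Lemma null_string_number_ge0 phi : (0 <= null_string_number phi)%E.
Proof. by apply: esup_ge0 => _ [F _ <-]; exact: ecard_ge0. Qed.

Lemma null_string_number_le phi : (null_string_number phi <= string_number phi)%E.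
Proof.
apply: esup_le => [|_ [F _ <-]|_ [F [Fnull Fdisj] <-]].
- exact: string_number_ge0.
- exact: ecard_ge0.
apply: esup_ub => [_ [F' _ <-]|]; first exact: ecard_ge0.
by exists F => //; split=> // S /Fnull[].
Qed.

Lemma group_null_string_number_le :
  (group_null_string_number G <= group_string_number G)%E.
Proof.
apply: esup_le => [|_ [phi _ <-]|_ [phi _ <-]].
- by apply: esup_ge0 => _ [phi _ <-]; exact: string_number_ge0.
- exact: null_string_number_ge0.
apply: le_trans (null_string_number_le phi) _.
apply: esup_ub => [_ [psi _ <-]|]; first exact: string_number_ge0.
by exists phi.
Qed.

Lemma finite_group_string_number : finite_set [set: G] ->
  group_string_number G = 0%E.
Proof.
move=> Gfin; have no_string phi S : ~ is_string phi S.
  move=> [Sinj _]; apply: infinite_nat.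
  apply: (@finite_preimage _ _ setT S); last exact: sub_finite_set Gfin.
  by move=> i j _ _; exact: Sinj.
apply/le_anti/andP; split; last first.
  by apply: esup_ge0 => _ [phi _ <-]; exact: string_number_ge0.
apply: esup_le => [//|_ [phi _ <-]|_ [phi _ <-]]; first exact: string_number_ge0.
apply: esup_le => [//|_ [F _ <-]|_ [F [Fstr _] <-]]; first exact: ecard_ge0.
suff -> : F = set0 by rewrite /ecard asboolT//= fset_set0.
by rewrite -subset0 => S /Fstr /no_string.
Qed.

Lemma iter_string phi S k n : (forall n, phi (S n.+1) = S n) ->
  iter k phi (S (n + k)%N) = S n.
Proof.
move=> Sphi; elim: k n => [|k IH] n; first by rewrite addn0.
by rewrite iterS addnS -addSn IH Sphi.
Qed.

(** The least power of [phi] annihilating [S i] is the one of exponent [i.+1],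
    so the index of a term can be read off from the term. *)
Lemma backward_orbit_inj phi S : (forall n, phi (S n.+1) = S n) ->
  phi (S 0%N) = 0 -> S 0%N != 0 -> injective S.
Proof.
move=> Sphi S00 S0.
have S_dies i k : iter (i + k.+1) phi (S i) = 0.
  rewrite addnC iterD (iter_string _ 0%N) ?add0n// iterSr S00.
  by elim: k => //= k ->; rewrite raddf0.
suff lt_neq i j : (i < j)%N -> S i = S j -> False.
  by move=> i j Sij; case: (ltngtP i j) => // lij;
    case: (lt_neq _ _ lij).
move=> ij Sij; case/eqP: S0.
rewrite -(iter_string j 0%N Sphi) add0n -Sij.
by rewrite -(subnKC ij) addSnnS S_dies.
Qed.

(** A single null string makes the supremum over all endomorphisms infinite:
    cutting it along the residue classes of the indices modulo [k] yields [k]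
    pairwise disjoint null strings of the [k]-th iterate of [phi]. *)
Lemma infinite_null_string_number phi S : (forall n, phi (S n.+1) = S n) ->
  phi (S 0%N) = 0 -> S 0%N != 0 -> group_null_string_number G = +oo%E.
Proof.
move=> Sphi S00 S0; have Sinj := backward_orbit_inj Sphi S00 S0.
have S_neq0 i : S i != 0.
  apply/eqP => Si; case/eqP: S0.
  rewrite -(iter_string i 0%N Sphi) add0n Si.
  by elim: (i) => //= k ->; rewrite raddf0.
suff ge_nat k : (0 < k)%N -> (k%:Z%:E <= group_null_string_number G)%E.
  move: ge_nat; case: (group_null_string_number G) => [[m|m]| |] // ge_nat.
  - by have := ge_nat m.+1 isT; rewrite lee_fin lez_nat ltnn.
  - by have := ge_nat 1%N isT.
  - by have := ge_nat 1%N isT.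
move=> k_gt0.
have [phik phikE] : exists psi : {additive G -> G}, forall x, psi x = iter k phi x.
  apply: additive_of => x y.
  by elim: (k) => //= i ->; rewrite raddfB.
have {}phikE : phik = iter k phi :> (G -> G) by apply/funext.
pose T i n := S (k * n + i)%N.
have phikT i n : phik (T i n.+1) = T i n.
  by rewrite phikE /T mulnS -addnA addnC iter_string.
have Tinj i i' n n' : (i < k)%N -> (i' < k)%N -> T i n = T i' n' -> i = i' /\ n = n'.
  move=> ik i'k /Sinj; rewrite ![(k * _)%N]mulnC => E.
  split; first by have := congr1 (modn^~ k) E; rewrite /= !modnMDl !modn_small.
  have := congr1 (divn^~ k) E.
  by rewrite /= !divnMDl// !divn_small// !addn0.
have Tnull i : (i < k)%N -> is_null_string phik (T i).
  move=> ik; split.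
  - split; first by move=> n n' /Tinj-/(_ ik ik)[].
    by case=> // n _; rewrite phikT.
  - exact: S_neq0.
  - exists 1%N => //=; rewrite phikE /T muln0 add0n.
    rewrite -(subnK (ltnW ik)) iterD -{3}(add0n i) iter_string//.
    rewrite -(prednK (_ : 0 < k - i)%N) ?subn_gt0// iterSr S00.
    by elim: (k - i).-1 => //= m ->; rewrite raddf0.
pose F := [set T i | i in `I_k].
have cardF : (F #= `I_k)%card.
  apply: inj_card_eq => i i'; rewrite !inE /= => ik i'k TT.
  by have [] := @Tinj i i' 0%N 0%N ik i'k (congr1 (fun f => f 0%N) TT).
have ecardF : ecard F = k%:Z%:E.
  rewrite /ecard asboolT ?(card_fset_set cardF)//.
  by apply/finite_setP; exists k.
rewrite -ecardF; apply: le_trans (_ : null_string_number phik <= _)%E.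
  apply: esup_ub => [_ [F' _ <-]|]; first exact: ecard_ge0.
  exists F => //; split; first by move=> _ [i ik <-]; exact: Tnull.
  move=> _ _ [i ik <-] [i' i'k <-] [x [[n _ <-] [n' _]]].
  by move=> /Tinj-/(_ i'k ik)[->].
apply: esup_ub => [_ [psi _ <-]|]; first exact: null_string_number_ge0.
by exists phik.
Qed.

End Strings.

(** * Triangular endomorphisms *)

Section IntegerCombinations.
Variables (G : zmodType) (b : nat -> G).
Implicit Types P Q : {poly int}.

(** Integer polynomials serve as the free abelian group on a countable basis,
    ['X^i] being mapped to [b i]. *)
Definition int_comb P : G := \sum_(i < size P) b i *~ P`_i.

Lemma int_comb_wide P m : (size P <= m)%N ->
  int_comb P = \sum_(i < m) b i *~ P`_i.
Proof.
move=> Pm; rewrite /int_comb -!(big_mkord xpredT (fun i => b i *~ P`_i)).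
rewrite (big_cat_nat _ Pm)//= [X in _ + X]big1_seq ?addr0// => i.
rewrite mem_index_iota => /and3P[_ Pi _].
by rewrite nth_default// mulr0z.
Qed.

Lemma int_comb_is_zmod_morphism : zmod_morphism int_comb.
Proof.
move=> P Q; pose m := maxn (size P) (size Q).
rewrite (@int_comb_wide P m) ?leq_maxl// (@int_comb_wide Q m) ?leq_maxr//.
rewrite (@int_comb_wide _ m); last first.
  by rewrite (leq_trans (size_polyD _ _))// size_polyN.
by rewrite -sumrB; apply: eq_bigr => i _; rewrite coefB mulrzBr.
Qed.

HB.instance Definition _ := GRing.isZmodMorphism.Build {poly int} G int_comb
  int_comb_is_zmod_morphism.

Lemma int_comb_poly m (E : nat -> int) :
  int_comb (\poly_(i < m) E i) = \sum_(i < m) b i *~ E i.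
Proof.
rewrite (int_comb_wide (size_poly _ _)); apply: eq_bigr => i _.
by rewrite coef_poly ltn_ord.
Qed.

Lemma int_combXn k : int_comb 'X^k = b k.
Proof.
rewrite /int_comb size_polyXn big_ord_recr /= coefXn eqxx mulr1z big1 ?add0r//.
by move=> i _; rewrite coefXn ltn_eqF// mulr0z.
Qed.

Lemma int_combMn_eq0 m P : (forall i, b i *+ m = 0) -> int_comb (P *+ m) = 0.
Proof.
move=> bm; rewrite /int_comb big1// => i _.
by rewrite coefMn -(mulr_natr P`_i) natz mulrC mulrzA -pmulrn bm mul0rz.
Qed.

(** Triangularity makes [phi] map the subgroup generated by the [b i] onto
    itself, so that [b 0] starts an infinite chain of preimages.  Allowing lower
    terms besides [b k] spares the caller the choice of dual families. *)
Lemma triangular_infinite_null_string_number (phi : {additive G -> G}) :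
  phi (b 0%N) = 0 -> b 0%N != 0 ->
  (forall k, exists R : {poly int},
    [/\ R \is monic, size R = k.+1 & phi (b k.+1) = int_comb R]) ->
  group_null_string_number G = +oo%E.
Proof.
move=> phib0 b0 phib.
have surj m P : (size P <= m)%N -> exists Q, phi (int_comb Q) = int_comb P.
  elim: m P => [|m IH] P Pm.
    by exists 0; move: Pm; rewrite leqn0 size_poly_eq0 => /eqP ->; rewrite !raddf0.
  have [R [Rmonic sizeR phiR]] := phib m.
  (* Subtracting the leading term lowers the degree. *)
  have [|Q QE] := IH (P - R *~ P`_m).
    apply/leq_sizeP => j; rewrite leq_eqVlt => /predU1P[<-|mj].
      have Rm : R`_m = 1 by rewrite -(monicP Rmonic) lead_coefE sizeR.
      by rewrite coefB coefMrz Rm -mulrzl mulr1 intz subrr.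
    rewrite coefB coefMrz [R`_j]nth_default ?sizeR// mul0rz subr0.
    exact: nth_default (leq_trans Pm mj).
  exists (Q + 'X^(m.+1) *~ P`_m).
  have phiXm : phi (int_comb ('X^(m.+1) *~ P`_m)) = int_comb (R *~ P`_m).
    by rewrite !raddfMz /= int_combXn phiR.
  by rewrite !raddfD /= QE phiXm -raddfD subrK.
have [next nextE] := choice (fun P => surj (size P) P (leqnn _)).
apply: (@infinite_null_string_number _ phi (fun n => int_comb (iter n next 'X^0))).
- by move=> n; rewrite /= nextE.
- by rewrite /= int_combXn.
- by rewrite /= int_combXn.
Qed.

End IntegerCombinations.

(** * Heights in abelian p-groups *)

Section PGroups.
Variables (p : nat) (p_prime : prime p).

(** Purity may be tested on the elements [e v *+ p ^ n]: if [v = w *+ p ^ j]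
    with [j <= n] and [e v] lies in [p ^ n.+1 G], then so does
    [e w *+ p ^ n = e v *+ p ^ (n - j)], whence [w] is divisible by [p] and [j]
    can be increased. *)
Lemma pure_of_socle (V G : zmodType) (e : {additive V -> G}) n :
  (forall v, multiples (p ^ n.+1) (e v *+ p ^ n) -> multiples p v) ->
  forall v, multiples (p ^ n.+1) (e v) -> multiples (p ^ n.+1) v.
Proof.
move=> soc v ev.
suff : forall j, (j <= n.+1)%N -> multiples (p ^ j) v by apply.
elim=> [_|j IH jn]; first by exists v; rewrite mulr1n.
have [w vE] := IH (ltnW jn).
have [u wE] : multiples p w.
  apply: soc; have -> : e w *+ p ^ n = e v *+ p ^ (n - j).
    by rewrite vE raddfMn -mulrnA -expnD subnKC.
  exact: multiples_dvd (dvdn_mulr _ (dvdnn _)) (multiplesMn _ ev).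
by exists u; rewrite vE wE expnS mulrnA.
Qed.

Variable G : zmodType.
Hypothesis pG : abelian_pgroup p G.

Lemma divisible_of_p_divisible (D : {pred G}) : zmod_closed D ->
  (forall x, x \in D -> exists2 y, y \in D & y *+ p = x) ->
  is_divisible_subgroup D.
Proof.
move=> Dz Dp; split=> // n x n_gt0 Dx.
have [m pm ->] := pfactor_coprime p_prime n_gt0.
have DpX k z : z \in D -> exists2 y, y \in D & y *+ p ^ k = z.
  elim: k z => [|k IH] z Dz'; first by exists z; rewrite ?mulr1n.
  by have [y Dy <-] := IH z Dz'; have [t Dt <-] := Dp y Dy; exists t;
    rewrite // expnS mulrnA.
have [y Dy <-] := DpX (logn p n) x Dx.
have [k yk] := pG y.
have [m0|m_gt0] := posnP m.
  by move: pm; rewrite m0 /coprime gcdn0 => /eqP p1; move: p_prime; rewrite p1.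
have cop : coprime m (p ^ k) by rewrite coprime_sym coprimeXl.
have [[u v] /= uvE] := coprimeP _ m_gt0 cop.
exists (y *+ u).
  have DMn : forall j, y *+ j \in D.
    case: Dz => D0 DB; elim=> [|j IH]; first by rewrite mulr0n.
    by rewrite mulrS -[y *+ j]opprK DB// -sub0r DB.
  exact: DMn.
have umE : (u * m = 1 + v * p ^ k)%N.
  by rewrite -uvE subnK// ltnW// -subn_gt0 uvE.
rewrite -mulrnA mulnA mulrnA umE mulrnDr mulr1n mulnC mulrnA yk mul0rn.
by rewrite addr0.
Qed.

(** If no element of the socle has finite height [N] or more, then [p ^ N G] is
    [p]-divisible: an element [y] of it with [y *+ p ^ k.+1 = 0] is corrected
    by a multiple of [p], chosen so that [y *+ p ^ k] is cancelled, and the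
    remainder has smaller order.  In a reduced group this forces
    [p ^ N G = 0]. *)
Lemma bounded_of_bounded_height N : reduced G ->
  (forall n (y : G), (N <= n)%N -> y *+ p ^ n.+1 = 0 ->
     multiples (p ^ n.+1) (y *+ p ^ n)) ->
  forall x : G, x *+ p ^ N = 0.
Proof.
move=> [_ redG] high x.
pose D : {pred G} := [pred x | `[< multiples (p ^ N) x >]].
have DP y : reflect (multiples (p ^ N) y) (y \in D) by exact: asboolP.
have Dz : zmod_closed D.
  split=> [|y z /DP Dy /DP Dz]; first by apply/DP; exact: multiples0.
  by apply/DP; exact: multiplesB.
suff Dp y : y \in D -> exists2 z, z \in D & z *+ p = y.
  apply/eqP; apply: (redG _ (divisible_of_p_divisible Dz Dp)).
  by apply/DP; exists x.
move=> /DP; have [k] := pG y.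
elim: k y => [|k IH] y.
  by rewrite mulr1n => -> _; exists 0; rewrite ?mul0rn//; apply/DP/multiples0.
move=> yk [a yE].
have [c cE] : multiples (p ^ (N + k).+1) (y *+ p ^ k).
  rewrite yE -mulrnA -expnD; apply: high; first exact: leq_addr.
  by rewrite -addnS expnD mulrnA -yE.
pose z := c *+ p ^ N.
have [||t Dt tE] := IH (y - z *+ p).
- rewrite mulrnBl cE -!mulrnA -addnS expnD expnS; apply/eqP.
  by rewrite subr_eq0 mulnA.
- apply: multiplesB; first by exists a.
  by exists (c *+ p); rewrite -!mulrnA mulnC.
exists (t + z); last by rewrite mulrnDl tE subrK.
by apply/DP; apply: multiplesD; [exact/DP|exists c].
Qed.

Lemma finite_of_finite_socle N : (forall x : G, x *+ p ^ N = 0) ->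
  finite_set [set x : G | x *+ p = 0] -> finite_set [set: G].
Proof.
move=> GN soc.
suff fin k : finite_set [set x : G | x *+ p ^ k = 0].
  by apply: (sub_finite_set _ (fin N)) => x _; exact: GN.
elim: k => [|k IH].
  by apply: (sub_finite_set _ (finite_set1 (0 : G))) => x /=; rewrite mulr1n.
have fib y : finite_set [set x : G | x *+ p = y].
  have [[z zE]|nz] := pselect (exists z, z *+ p = y).
    apply: (sub_finite_set _ (finite_image (fun x => x + z) soc)) => x /= xE.
    by exists (x - z); rewrite ?subrK// mulrnBl xE zE subrr.
  by apply: (sub_finite_set _ (@finite_set0 G)) => x /= xE; apply: nz; exists x.
apply: (sub_finite_set _ (bigcup_finite IH (fun y _ => fib y))) => x /=.
by rewrite expnS mulrnA => xk; exists (x *+ p).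
Qed.

End PGroups.

(** * Groups with cyclic summands of unbounded order *)

Section Unbounded.
Variables (p : nat) (p_prime : prime p) (G : zmodType).
Hypothesis pG : abelian_pgroup p G.

(** A cyclic direct summand of order [p ^ log_order], given by a generator and
    the projection onto it; the latter is written in integer coordinates,
    additive only modulo the order, so that it can be composed with the maps
    from this summand sending its generator to any element whose order divides
    [p ^ log_order]. *)
Record cyclic_summand := CyclicSummand {
  generator : G;
  log_order : nat;
  coordinate : G -> int;
  generatorX : generator *+ p ^ log_order = 0;
  generator_faithful : forall c : int,
    generator *~ c = 0 -> multiples (p ^ log_order) c;
  coordinateB : forall x y, multiples (p ^ log_order)
    (coordinate (x - y) - (coordinate x - coordinate y));
  coordinate_generator : multiples (p ^ log_order) (coordinate generator - 1);
}.

(** An element [a *+ p ^ n] of the socle of height exactly [n] makes [a]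
    generate a pure subgroup, and bounded pure subgroups are direct summands. *)
Lemma cyclic_summand_of_socle n (a : G) :
  a *+ p ^ n.+1 = 0 -> ~ multiples (p ^ n.+1) (a *+ p ^ n) ->
  exists C : cyclic_summand, log_order C = n.+1.
Proof.
move=> an a_high.
have [e eE] : exists e : {additive int -> G}, forall c, e c = a *~ c.
  by apply: additive_of => c d; rewrite mulrzBr.
have epure : forall c, multiples (p ^ n.+1) (e c) -> multiples (p ^ n.+1) c.
  apply: pure_of_socle => c; rewrite eE => ac.
  apply: contrapT => pc; apply: a_high.
  have [|u [v uv]] := @prime_coprimez _ p_prime c.
    by move=> /dvdzP[d dE]; apply: pc; exists d; rewrite dE -mulr_natr natz.
  have -> : a *+ p ^ n = a *~ c *+ p ^ n *~ u.
    rewrite -[LHS]mulr1z -uv mulrzDr [v * _]mulrC [X in _ + X]mulrzA -pmulrn.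
    rewrite -mulrnA -expnSr an mul0rz addr0 [u * c]mulrC mulrzA.
    by congr (_ *~ _); rewrite !pmulrn mulrzAC.
  exact: multiplesMz.
have int_tf (c : int) : c *+ p = 0 -> c = 0.
  by move=> /eqP; rewrite mulrn_eq0 gtn_eqF ?prime_gt0//= => /eqP.
have [chi [chiB chie]] := retraction_mod_pure p_prime int_tf epure.
have a_faithful (c : int) : a *~ c = 0 -> multiples (p ^ n.+1) c.
  by rewrite -eE => ec0; apply: epure; rewrite ec0; exact: multiples0.
have chia : multiples (p ^ n.+1) (chi a - 1) by have := chie 1; rewrite eE mulr1z.
by exists (CyclicSummand an a_faithful chiB chia).
Qed.

Lemma coordinate_scale_additive (C : cyclic_summand) (a : G) :
  a *+ p ^ log_order C = 0 ->
  exists f : {additive G -> G}, forall x, f x = a *~ coordinate C x.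
Proof.
move=> aC; apply: additive_of => x y; apply/eqP; rewrite -mulrzBr -subr_eq0 -mulrzBr.
exact/eqP/(mulrz_multiples_eq0 aC)/coordinateB.
Qed.

(** An element of small order has a highly divisible coordinate; this is what
    makes the sum in [unbounded_infinite_null_string_number] locally finite. *)
Lemma coordinate_of_torsion (C : cyclic_summand) x k :
  (k <= log_order C)%N -> x *+ p ^ k = 0 ->
  multiples (p ^ (log_order C - k)) (coordinate C x).
Proof.
move=> kC xk.
have [f fE] := coordinate_scale_additive (generatorX C).
have [|d dE] := @generator_faithful C (coordinate C x *+ p ^ k).
  rewrite -mulr_natr natz mulrzA -fE -pmulrn -raddfMn xk; exact: raddf0.
exists d; apply/eqP; rewrite -subr_eq0; apply/eqP.
have : (coordinate C x - d *+ p ^ (log_order C - k)) *+ p ^ k = 0.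
  by rewrite mulrnBl dE -mulrnA -expnD subnK// subrr.
by move/eqP; rewrite mulrn_eq0 expn_eq0 (gtn_eqF (prime_gt0 p_prime)) => /eqP.
Qed.

(** Choose summands with generators [b i] whose exponents [n i] more than double
    at each step.  The map [psi i], projecting onto the summand of [b i.+1] and
    sending that generator to [b i], annihilates every element of order at
    most [p ^ n i], because [n i.+1 - n i >= n i].  Hence the sum of all
    [psi i] is a well-defined endomorphism, and its value at [b k] involves
    only the [psi i] with [i < k]: it is triangular, whatever the position of
    the summands with respect to each other. *)
Lemma unbounded_infinite_null_string_number :
  (forall N, exists C : cyclic_summand, (N <= log_order C)%N) ->
  group_null_string_number G = +oo%E.
Proof.
move=> /choice[pick pickP].
pose fix C i := if i is j.+1 then pick (log_order (C j)).*2.+1 else pick 1%N.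
pose n i := log_order (C i).
pose b i := generator (C i).
have n_dbl i : ((n i).*2 < n i.+1)%N by exact: pickP.
have n_lt i : (i < n i)%N.
  elim: i => [|i IH]; first exact: pickP.
  by apply: leq_trans (n_dbl i); rewrite ltnS -addnn (leq_trans IH)// leq_addr.
have n_mono i j : (i <= j)%N -> (n i <= n j)%N.
  elim: j => [|j IH]; first by rewrite leqn0 => /eqP ->.
  rewrite leq_eqVlt => /predU1P[->//|/IH ij].
  by apply: leq_trans ij (leq_trans _ (ltnW (n_dbl j))); rewrite -addnn leq_addr.
have bX i k : (n i <= k)%N -> b i *+ p ^ k = 0.
  by move=> ik; rewrite -(subnKC ik) expnD mulrnA generatorX mul0rn.
pose psi i x := b i *~ coordinate (C i.+1) x.
have psiB i x y : psi i (x - y) = psi i x - psi i y.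
  have [|f fE] := @coordinate_scale_additive (C i.+1) (b i); first exact/bX/n_mono.
  by rewrite /psi -!fE raddfB.
have psi0 i k x : x *+ p ^ k = 0 -> (k <= n i)%N -> psi i x = 0.
  move=> xk ki.
  have kC : (k <= n i.+1)%N by apply: leq_trans ki (n_mono _ _ _).
  apply: (mulrz_multiples_eq0 _ (coordinate_of_torsion kC xk)).
  apply: bX; rewrite leq_subRL//; apply: leq_trans (ltnW (n_dbl i)).
  by rewrite -addnn leq_add2r.
have [o oP] := choice pG.
pose f x := \sum_(i < o x) psi i x.
have fE x M : (forall i, (M <= i)%N -> psi i x = 0) -> f x = \sum_(i < M) psi i x.
  move=> xM.
  have widen m m' : (forall i, (m <= i)%N -> psi i x = 0) -> (m <= m')%N ->
      \sum_(i < m) psi i x = \sum_(i < m') psi i x.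
    move=> xm mm'; rewrite -!(big_mkord xpredT (psi^~ x)).
    rewrite [RHS](big_cat_nat _ mm')//= [X in _ + X]big1_seq ?addr0// => i.
    by rewrite mem_index_iota => /and3P[_ mi _]; exact: xm.
  have xo i : (o x <= i)%N -> psi i x = 0.
    by move=> oi; apply: psi0 (oP x) (leq_trans oi (ltnW (n_lt i))).
  by rewrite /f (widen _ _ xo (leq_maxl (o x) M)) (widen _ _ xM (leq_maxr (o x) M)).
have [phi phiE] : exists phi : {additive G -> G}, forall x, phi x = f x.
  apply: additive_of => x y; pose M := maxn (o x) (o y).
  have xM i : (M <= i)%N -> psi i x = 0.
    rewrite geq_max => /andP[oi _].
    exact: psi0 (oP x) (leq_trans oi (ltnW (n_lt i))).
  have yM i : (M <= i)%N -> psi i y = 0.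
    rewrite geq_max => /andP[_ oi].
    exact: psi0 (oP y) (leq_trans oi (ltnW (n_lt i))).
  rewrite (fE x M xM) (fE y M yM) (fE _ M) => [|i Mi].
    by rewrite -sumrB; apply: eq_bigr => i _; rewrite psiB.
  by rewrite psiB xM// yM// subr0.
have phib k : phi (b k) = \sum_(i < k) psi i (b k).
  rewrite phiE; apply: fE => i ki.
  exact: psi0 (bX k _ (leqnn _)) (n_mono _ _ ki).
apply: (@triangular_infinite_null_string_number G b phi).
- by rewrite phib big_ord0.
- apply/eqP => b0; have [|d] := @generator_faithful (C 0%N) 1.
    by rewrite mulr1z.
  have -> : log_order (C 0%N) = (n 0%N).-1.+1 by rewrite prednK// n_lt.
  move/(congr1 (fun c : int => (p%:Z %| c)%Z)).
  rewrite expnS mulnC mulrnA -mulr_natr natz dvdz_mull// dvdz1 /=.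
  by move=> p1; move: p_prime; rewrite (eqP p1).
- move=> k.
  (* The coefficient of [b k] is congruent to 1 modulo the order of [b k], and
     may be replaced by 1. *)
  pose E i := if i == k then 1 else coordinate (C i.+1) (b k.+1).
  have sizeR : size (\poly_(i < k.+1) E i) = k.+1.
    by apply: size_poly_eq; rewrite /E eqxx oner_eq0.
  exists (\poly_(i < k.+1) E i); split=> //.
    by rewrite monicE lead_coefE sizeR /= coef_poly ltnSn /E eqxx.
  rewrite phib int_comb_poly !big_ord_recr /= /E eqxx; congr (_ + _).
    by apply: eq_bigr => i _; rewrite ltn_eqF.
  have bC : b k *+ p ^ log_order (C k.+1) = 0 by exact/bX/n_mono.
  have := mulrz_multiples_eq0 bC (@coordinate_generator (C k.+1)).
  by rewrite mulrzBr => /eqP; rewrite subr_eq0 => /eqP.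
Qed.

End Unbounded.

(** * Infinite bounded groups *)

Section Bounded.
Variables (p : nat) (p_prime : prime p) (G : zmodType).

Lemma finite_adjoin_prime_order (L : set G) (x : G) :
  finite_set L -> x *+ p = 0 ->
  finite_set [set y | exists h (c : int), L h /\ y = h + x *~ c].
Proof.
move=> Lfin xp.
apply: (sub_finite_set _ (finite_image2 (fun h c => h + x *+ c) Lfin (finite_II p))).
move=> y [h [c [Lh ->]]].
have p0 : p%:Z != 0 by rewrite eqz_nat gtn_eqF// prime_gt0.
exists h => //; exists `|(c %% p%:Z)%Z|%N => /=.
  by rewrite -ltz_nat gez0_abs ?modz_ge0// ltz_pmod// ltz_nat prime_gt0.
rewrite [in RHS](divz_eq c p%:Z) mulrzDr [(_ * p%:Z)]mulrC mulrzA -!pmulrn xp mul0rz.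
by rewrite add0r pmulrn gez0_abs ?modz_ge0.
Qed.

(** The elements [b i *+ p ^ n] are chosen one after the other in the infinite
    layer, avoiding at each step the subgroup [L i] spanned by the finite layer
    and the previous choices, which stays finite.  They are thus linearly
    independent over the prime field, modulo the finite layer. *)
Lemma independent_sequence n :
  infinite_set [set x : G | x *+ p = 0 /\ multiples (p ^ n) x] ->
  finite_set [set x : G | x *+ p = 0 /\ multiples (p ^ n.+1) x] ->
  exists b : nat -> G, (forall i, b i *+ p ^ n.+1 = 0) /\
    forall P, multiples (p ^ n.+1) (int_comb b P *+ p ^ n) -> multiples p P.
Proof.
set W := [set x : G | x *+ p = 0 /\ multiples (p ^ n.+1) x].
move=> Sinf Wfin.
have /choice[pick pickP] : forall L : set G, exists b : G, finite_set L ->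
    b *+ p ^ n.+1 = 0 /\ ~ L (b *+ p ^ n).
  move=> L; have [Lfin|Linf] := pselect (finite_set L); last by exists 0.
  have [x [[+ [b xE]] +]] := infinite_setN0 (infinite_setD Sinf Lfin).
  by rewrite xE => xp Lx; exists b => _; split=> //; rewrite expnSr mulrnA.
pose fix L (i : nat) : set G := if i is j.+1 then
  [set y | exists h (c : int), L j h /\ y = h + pick (L j) *+ p ^ n *~ c] else W.
pose b i := pick (L i).
pose x i := b i *+ p ^ n.
have Lfin i : finite_set (L i).
  elim: i => [//|i IH]; apply: finite_adjoin_prime_order => //.
  by rewrite -mulrnA -expnSr; have [] := pickP _ IH.
have bX i : b i *+ p ^ n.+1 = 0 by have [] := pickP _ (Lfin i).
have xL i : ~ L i (x i) by have [] := pickP _ (Lfin i).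
have xp i : x i *+ p = 0 by rewrite -mulrnA -expnSr.
have LS i : L i `<=` L i.+1.
  by move=> h Lh; exists h, 0; rewrite mulr0z addr0.
have LB i h h' : L i h -> L i h' -> L i (h - h').
  elim: i h h' => [|i IH] h h'.
    move=> [hp hm] [hp' hm']; split; last exact: multiplesB.
    by rewrite mulrnBl hp hp' subrr.
  move=> [g [c [Lg ->]]] [g' [c' [Lg' ->]]]; exists (g - g'), (c - c').
  by split; [exact: IH|rewrite mulrzBr opprD addrACA].
have LMz i h c : L i h -> L i (h *~ c).
  move=> Lh; have L0 : L i 0 by rewrite -(subrr h); exact: (LB).
  have LMn m : L i (h *+ m).
    elim: m => [//|m IH]; rewrite mulrS -[h *+ m]opprK; apply: (LB) => //.
    by rewrite -sub0r; exact: (LB).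
  case: c => m; first exact: LMn.
  by rewrite NegzE mulrNz -sub0r; apply: (LB) => //; exact: LMn.
have Lcomb m (c : nat -> int) : L m (\sum_(i < m) x i *~ c i).
  elim: m => [|m IH].
    by rewrite big_ord0; split; [rewrite mul0rn|exact: multiples0].
  by rewrite big_ord_recr /=; exists (\sum_(i < m) x i *~ c i), (c m).
have W_sub m : W `<=` L m by elim: m => // m IH; exact: subset_trans IH (LS m).
(* If [c m] were prime to [p], then [x m] would lie in [L m]. *)
have coef_dvd m (c : nat -> int) : W (\sum_(i < m) x i *~ c i) ->
    forall i, (i < m)%N -> multiples p (c i).
  elim: m => [//|m IH]; rewrite big_ord_recr /= => Wc.
  have [d dE] : multiples p (c m).
    apply: contrapT => pc; have [|u [v uv]] := @prime_coprimez _ p_prime (c m).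
      by move=> /dvdzP[d dE]; apply: pc; exists d; rewrite dE -mulr_natr natz.
    apply: (xL m); rewrite -[x m]mulr1z -uv mulrzDr [v * _]mulrC.
    rewrite [X in _ + X]mulrzA -pmulrn xp mul0rz addr0 [u * _]mulrC mulrzA.
    apply: LMz; rewrite -[x m *~ _](addKr (\sum_(i < m) x i *~ c i)) addrC.
    by apply: (LB) => //; exact: W_sub.
  move=> i; rewrite ltnS leq_eqVlt => /predU1P[->|]; first by exists d.
  apply: IH; move: Wc; rewrite (mulrz_multiples_eq0 (xp m)) ?addr0//.
  by exists d.
exists b; split=> // P Pn.
have /coef_dvd Pp : W (\sum_(i < size P) x i *~ P`_i).
  have -> : \sum_(i < size P) x i *~ P`_i = int_comb b P *+ p ^ n.
    by rewrite -sumrMnl; apply: eq_bigr => i _; rewrite /x !pmulrn mulrzAC.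
  split=> //; rewrite -mulrnA -expnSr -raddfMn.
  exact: int_combMn_eq0.
exists (\poly_(i < size P) (P`_i %/ p%:Z)%Z); apply/polyP => i.
rewrite coefMn coef_poly; case: ltnP => [/Pp[d ->]|Pi].
  rewrite -[in RHS]mulr_natr natz -[d *+ p]mulr_natr natz mulzK//.
  by rewrite eqz_nat gtn_eqF// prime_gt0.
by rewrite nth_default// mul0rn.
Qed.

(** The independent sequence spans a pure subgroup which is a direct sum of
    cyclic groups of order [p ^ n.+1]; composing a retraction onto it with the
    backward shift of its basis gives the endomorphism. *)
Lemma infinite_null_string_number_of_layer n :
  infinite_set [set x : G | x *+ p = 0 /\ multiples (p ^ n) x] ->
  finite_set [set x : G | x *+ p = 0 /\ multiples (p ^ n.+1) x] ->
  group_null_string_number G = +oo%E.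
Proof.
move=> Sinf Wfin; have [b [bX bsoc]] := independent_sequence Sinf Wfin.
have poly_tf (P : {poly int}) : P *+ p = 0 -> P = 0.
  move=> Pp; apply/polyP => i; have /eqP := congr1 (fun Q : {poly int} => Q`_i) Pp.
  by rewrite coefMn !coef0 mulrn_eq0 (gtn_eqF (prime_gt0 p_prime)) => /eqP.
have pure := pure_of_socle bsoc.
have [chi [chiB chib]] := retraction_mod_pure p_prime poly_tf pure.
pose shift P := int_comb b (drop_poly 1 P).
have shiftB P Q : shift (P - Q) = shift P - shift Q by rewrite /shift !raddfB.
have shift_eq P Q : multiples (p ^ n.+1) (P - Q) -> shift P = shift Q.
  move=> [R PQ]; apply/eqP; rewrite -subr_eq0 -shiftB PQ /shift raddfMn.
  by apply/eqP/int_combMn_eq0.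
have [phi phiE] : exists phi : {additive G -> G}, forall x, phi x = shift (chi x).
  by apply: additive_of => x y; rewrite -shiftB; exact/shift_eq/chiB.
have phib k : phi (b k) = shift 'X^k.
  by rewrite phiE -(int_combXn b k); exact/shift_eq/chib.
apply: (@triangular_infinite_null_string_number G b phi).
- by rewrite phib /shift drop_poly_eq0 ?size_polyXn// raddf0.
- apply/eqP => b0; have [|P PE] := bsoc 'X^0.
    by rewrite int_combXn b0 mul0rn; exact: multiples0.
  have : (p%:Z %| 1)%Z.
    apply/dvdzP; exists P`_0; rewrite -[p%:Z]natz mulr_natr -coefMn -PE.
    by rewrite coefXn.
  by rewrite dvdz1 /= => /eqP p1; move: p_prime; rewrite p1.
- move=> k; exists 'X^k; rewrite monicXn size_polyXn phib int_combXn; split=> //.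
  by rewrite /shift -[k.+1]addn1 exprD expr1 -['X]expr1 drop_polyMXn_id int_combXn.
Qed.

(** The socle is infinite while its intersections with the [p ^ n G] end at 0,
    so some layer is infinite and the next one finite. *)
Lemma bounded_infinite_null_string_number N :
  (forall x : G, x *+ p ^ N = 0) -> infinite_set [set: G] ->
  group_null_string_number G = +oo%E.
Proof.
move=> GN Ginf.
pose S n := [set x : G | x *+ p = 0 /\ multiples (p ^ n) x].
have exP : exists n, `[< finite_set (S n) >].
  exists N; apply/asboolP.
  apply: (sub_finite_set _ (finite_set1 (0 : G))) => _ [_ [y ->]] /=.
  exact: GN.
have [[|n] /asboolP Sn Smin] := ex_minnP exP.
  exfalso; apply/Ginf/(finite_of_finite_socle GN).
  apply: (sub_finite_set _ Sn) => x xp; split=> //.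
  by exists x; rewrite mulr1n.
apply: (infinite_null_string_number_of_layer _ Sn) => Sfin.
by have := Smin n (asboolT Sfin); rewrite ltnn.
Qed.

End Bounded.

(** * Reduced groups *)

(** Either the finite heights in the socle are bounded, and then so is [G], or
    there are cyclic summands of arbitrarily large order. *)
Lemma reduced_infinite_null_string_number (p : nat) (G : zmodType) :
  prime p -> abelian_pgroup p G -> reduced G -> infinite_set [set: G] ->
  group_null_string_number G = +oo%E.
Proof.
move=> p_prime pG redG Ginf.
have [[N low]|high] := pselect (exists N, forall n (y : G), (N <= n)%N ->
    y *+ p ^ n.+1 = 0 -> multiples (p ^ n.+1) (y *+ p ^ n)).
  have GN := bounded_of_bounded_height p_prime pG redG low.
  exact: bounded_infinite_null_string_number GN Ginf.
apply: (unbounded_infinite_null_string_number p_prime pG) => N.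
apply: contrapT => noC; apply: high; exists N => n y Nn yn.
apply: contrapT => y_high; apply: noC.
have [C CE] := cyclic_summand_of_socle p_prime yn y_high.
by exists C; rewrite CE ltnW.
Qed.

Theorem theorem3p4 (p : nat) (G : zmodType) (p_prime : prime p)
    (pG : abelian_pgroup p G) (redG : reduced G) :
  [<-> group_string_number G = 0%E;
       group_null_string_number G = 0%E;
       finite_set [set: G]]
  /\ group_string_number G = group_null_string_number G.
Proof.
have s0_ge0 : (0 <= group_null_string_number G)%E.
  by apply: esup_ge0 => _ [phi _ <-]; exact: null_string_number_ge0.
have s0_le := group_null_string_number_le G.
have [Gfin|Ginf] := pselect (finite_set [set: G]).
  have s_eq0 := finite_group_string_number Gfin.
  have s0_eq0 : group_null_string_number G = 0%E.
    by apply/le_anti/andP; split; rewrite // -s_eq0.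
  by split; [tfae|rewrite s_eq0 s0_eq0].
have s0_oo := reduced_infinite_null_string_number p_prime pG redG Ginf.
have s_oo : group_string_number G = +oo%E.
  by apply/le_anti/andP; split; [exact: leey|rewrite -s0_oo].
by split; [tfae => //; rewrite ?s0_oo ?s_oo|rewrite s0_oo s_oo].
Qed.
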